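(* Let $\mathcal{H}=\mathcal{H}(X)$ be a reproducing kernel Hilbert space on a nonempty set $X$, let $A\in\mathcal{B}(\mathcal{H})^+$, and let $M,N\in\mathcal{B}_A(\mathcal{H})$ have closed ranges, with the pairs $(A,\mathcal{R}(M))$, $(A,\mathcal{N}(M))$, $(A,\mathcal{R}(N))$ and $(A,\mathcal{N}(N))$ compatible. Let $N^{\dagger_A}$ be an $A$-generalized inverse of $N$. Then $$\mathbf{ber}_A^2(M+N)\leq\mathbf{ber}_A^2(M)+\mathbf{ber}_A(M)\,\mathbf{ber}_A(N^{\#_A}N+NN^{\dagger_A})+\frac14\,\mathbf{ber}_A(N^{\#_A}N+NN^{\#_A})+\frac12\,\mathbf{ber}_A(N^2).$$
   Context: A reproducing kernel Hilbert space $\mathcal{H}(X)$ is a complex Hilbert space of complex-valued functions on $X$ on which every evaluation $\phi\mapsto\phi(x)$, $x\in X$, is continuous; $k_x\in\mathcal{H}$ is the element with $\phi(x)=\langle\phi,k_x\rangle$ for all $\phi\in\mathcal{H}$. $\mathcal{B}(\mathcal{H})$ is the algebra of bounded linear operators on $\mathcal{H}$, $\mathcal{B}(\mathcal{H})^+=\{T\in\mathcal{B}(\mathcal{H}):\langle Tu,u\rangle\ge0\ \forall u\in\mathcal{H}\}$; $\mathcal{R}(T)$, $\mathcal{N}(T)$ denote range and null space. For $A\in\mathcal{B}(\mathcal{H})^+$: $\langle u,v\rangle_A=\langle Au,v\rangle$ and $\|u\|_A=\langle u,u\rangle_A^{1/2}$. $\mathcal{B}_A(\mathcal{H})=\{T\in\mathcal{B}(\mathcal{H}):\mathcal{R}(T^*A)\subseteq\mathcal{R}(A)\}$.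 For $T\in\mathcal{B}_A(\mathcal{H})$, $T^{\#_A}$ is the unique $Y\in\mathcal{B}(\mathcal{H})$ with $AY=T^*A$ and $\mathcal{R}(Y)\subseteq\overline{\mathcal{R}(A)}$; in particular $\langle Tu,v\rangle_A=\langle u,T^{\#_A}v\rangle_A$. For a closed subspace $V$, the pair $(A,V)$ is compatible if there is $Q\in\mathcal{B}(\mathcal{H})$ with $Q^2=Q$, $\mathcal{R}(Q)=V$, $AQ=Q^*A$. An $A$-generalized inverse of a closed-range operator $T$ is an operator $T^{\dagger_A}\in\mathcal{B}(\mathcal{H})$ with $TT^{\dagger_A}T=T$, $T^{\dagger_A}TT^{\dagger_A}=T^{\dagger_A}$, $ATT^{\dagger_A}=(TT^{\dagger_A})^*A$, $AT^{\dagger_A}T=(T^{\dagger_A}T)^*A$. (Known: it exists if and only if $(A,\mathcal{R}(T))$ and $(A,\mathcal{N}(T))$ are compatible.) The $A$-normalized reproducing kernel is $\hat k_x'=k_x/\|k_x\|_A$, for those $x\in X$ with $\|k_x\|_A\neq0$. The $A$-Berezin number is $\mathbf{ber}_A(T)=\sup_{x}|\langle T\hat k_x',\hat k_x'\rangle_A|$, the supremum being over $x\in X$ with $\|k_x\|_A\ne0$. $\mathbf{ber}_A^{p}(T)$ means $(\mathbf{ber}_A(T))^p$. *)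

(* Defs.v *)
From HB Require Import structures.
From mathcomp Require Export all_boot all_order all_algebra.
From mathcomp Require Export sesquilinear.
From mathcomp Require Export complex.
From mathcomp Require Export all_classical all_reals all_analysis.

Set Implicit Arguments.
Unset Strict Implicit.
Unset Printing Implicit Defensive.

Import Order.TTheory GRing.Theory Num.Theory.
Import numFieldNormedType.Exports.

Local Open Scope classical_set_scope.
Local Open Scope complex_scope.
Local Open Scope ring_scope.

(* The elements of the space are identified with functions on [X] through the
   injective linear map [fev]; the inner product is linear in its first
   argument and conjugate-linear in the second. *)
Record rkhs (R : realType) (X : Type) := RKHS {
  rkhs_sort :> completeNormedModType R[i] ;
  dot : {dot rkhs_sort for (@Num.conj R[i])} ;
  dot_norm : forall u, dot u u = `|u| ^+ 2 ;
  fev : rkhs_sort -> X -> R[i] ;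
  fev_linear : forall (x : X) (a : R[i]) (u v : rkhs_sort),
    fev (a *: u + v) x = a * fev u x + fev v x ;
  fev_inj : injective fev ;
  fev_continuous : forall x : X,
    continuous (fun u : rkhs_sort => fev u x : (R[i])^o) }.

Section Operators.
Context {R : realType} {X : Type} {H : rkhs R X}.
Implicit Types (T S A P Q Y : H -> H) (V : set H) (u v : H) (x : X).

(* Existence of [k_x] and of the adjoint below is the Riesz representation
   theorem; uniqueness is nondegeneracy of [dot]. *)
Definition rker x : H := get [set k : H | forall u, fev u x = dot H u k].

Definition bounded_op : set (H -> H) :=
  [set T | linear T /\ exists C : R, forall u, `|T u| <= C%:C * `|u|].

Definition adj T : H -> H :=
  get [set S : H -> H | bounded_op S /\
                        forall u v, dot H (T u) v = dot H u (S v)].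

(* [0 <= z] for [z : R[i]] means that [z] is real and nonnegative. *)
Definition positive_op : set (H -> H) :=
  [set T | bounded_op T /\ forall u, 0 <= dot H (T u) u].

Definition nullspace T : set H := [set u | T u = 0].

Definition dotA A u v : R[i] := dot H (A u) v.

Definition normA A u : R := Num.sqrt (complex.Re (dotA A u u)).

Definition BA A : set (H -> H) :=
  [set T | bounded_op T /\ range (adj T \o A) `<=` range A].

(* [Y] is T^{#_A}: such a [Y] is unique, and exists when [BA A T] (Douglas). *)
Definition is_sharpA A T Y : Prop :=
  [/\ bounded_op Y, A \o Y = adj T \o A & range Y `<=` closure (range A)].

Definition compatible A V : Prop :=
  exists Q : H -> H,
    [/\ bounded_op Q, Q \o Q = Q, range Q = V & A \o Q = adj Q \o A].

Definition is_ginvA A T S : Prop :=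
  [/\ bounded_op S,
      T \o S \o T = T,
      S \o T \o S = S,
      A \o (T \o S) = adj (T \o S) \o A
    & A \o (S \o T) = adj (S \o T) \o A].

Definition nkerA A x : H := ((normA A (rker x))^-1)%:C *: rker x.

(* The supremum is taken in [0, +oo]: adding 0 to a set of nonnegative numbers
   matters only when the set is empty (that is, when [A = 0]). *)
Definition berA A T : \bar R :=
  ereal_sup ([set 0%E] `|`
    [set (complex.Re `|dotA A (T (nkerA A x)) (nkerA A x)|)%:E
      | x in [set x | normA A (rker x) != 0]]).

End Operators.

(* Main.v *)
Require Import Defs.
From mathcomp Require Import ring lra.

Set Implicit Arguments.
Unset Strict Implicit.
Unset Printing Implicit Defensive.

Import Order.TTheory GRing.Theory Num.Theory.
Import numFieldNormedType.Exports.

Local Open Scope classical_set_scope.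
Local Open Scope ring_scope.

(** Fix a point where the kernel has nonzero [A]-seminorm and let [k] be the
    [A]-normalized kernel there.  With [a = |<Mk,k>_A|] and [b = |<Nk,k>_A|],
    the quantity to bound is at most [(a + b)^2 = a^2 + a (2 b) + b^2], so two
    estimates on [b] suffice.

    Linear term: [P = N Ndag] is idempotent, self-adjoint for [<.,.>_A], and
    fixes the range of [N]; hence [<Nk,k>_A = <Nk,Pk>_A], and the inequality
    [2 |<u,v>_A| <= <u,u>_A + <v,v>_A] gives [2 b <= <(Nsharp N + P)k,k>_A]
    ([psd_projection_bound]).

    Quadratic term: [b^2 = |<Nk,k>_A <k,Nsharp k>_A|] is the left-hand side of
    Buzano's inequality for the unit vector [k], whose right-hand side is
    bounded by [<(Nsharp N + N Nsharp)k,k>_A / 4 + |<N^2 k,k>_A| / 2]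
    ([psd_square_bound]).

    Each pointwise value is at most the corresponding Berezin number, and all
    the terms are nonnegative, so the inequality passes to the suprema in
    [[0, +oo]], infinite values included.

    The hypotheses on [Nsharp] and [Ndag] speak of the Hilbert adjoint [adj],
    a choice operator that has its meaning only once an adjoint exists.  That is
    the Riesz representation theorem, proved here by minimizing
    [|u|^2 - 2 Re (f u)] over the space ([riesz_representation], [adjP]). *)

(** * Positive semidefinite sesquilinear forms *)

(** The common structure of the inner product and of [<.,.>_A], which may be
    degenerate.  Hermitian symmetry is left out because positivity implies it
    over the complex numbers, see [psd_herm]. *)
Record psd_form (C : numClosedFieldType) (U : lmodType C) (B : U -> U -> C)
    : Prop := PsdForm {
  psd_linl : forall a u v w, B (a *: u + v) w = a * B u w + B v w ;
  psd_linr : forall a u v w, B u (a *: v + w) = a^* * B u v + B u w ;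
  psd_ge0 : forall u, 0 <= B u u }.

Section PsdForm.
Variables (C : numClosedFieldType) (U : lmodType C) (B : U -> U -> C).
Hypothesis psdB : psd_form B.
Implicit Types (a : C) (u v w e : U).

Lemma psdDl u v w : B (u + v) w = B u w + B v w.
Proof. by have := psd_linl psdB 1 u v w; rewrite scale1r mul1r. Qed.

Lemma psdDr u v w : B u (v + w) = B u v + B u w.
Proof. by have := psd_linr psdB 1 u v w; rewrite scale1r rmorph1 mul1r. Qed.

Lemma psd0l u : B 0 u = 0.
Proof. by apply: (@addrI _ (B 0 u)); rewrite -psdDl !addr0. Qed.

Lemma psd0r u : B u 0 = 0.
Proof. by apply: (@addrI _ (B u 0)); rewrite -psdDr !addr0. Qed.

Lemma psdZl a u v : B (a *: u) v = a * B u v.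
Proof. by have := psd_linl psdB a u 0 v; rewrite !addr0 psd0l addr0. Qed.

Lemma psdZr a u v : B u (a *: v) = a^* * B u v.
Proof. by have := psd_linr psdB a u v 0; rewrite !addr0 psd0r addr0. Qed.

Lemma psdNl u v : B (- u) v = - B u v.
Proof. by rewrite -scaleN1r psdZl mulN1r. Qed.

Lemma psdNr u v : B u (- v) = - B u v.
Proof. by rewrite -scaleN1r psdZr rmorphN1 mulN1r. Qed.

Definition psdE := (psdDl, psdDr, psdZl, psdZr, psdNl, psdNr).

Lemma psd_conj u : (B u u)^* = B u u.
Proof. exact/CrealP/ger0_real/(psd_ge0 psdB). Qed.

(** Polarization: [B] is real at [u + v] and at [u + 'i *: v]; these two facts
    determine the real and imaginary parts of [B v u]. *)
Lemma psd_herm u v : B v u = (B u v)^*.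
Proof.
have h1 := psd_conj (u + v); have h2 := psd_conj (u + 'i *: v).
move: h1 h2; rewrite !psdE !rmorphD !rmorphM /= conjCK !psd_conj conjCi => h1 h2.
have i20 : 'i * 2 != 0 :> C by rewrite mulf_neq0 ?neq0Ci ?pnatr_eq0.
apply: (mulfI i20); apply/esym/subr0_eq.
have h3 := congr2 (fun x y : C => 'i * x + y) h1 h2.
by move/eqP: h3; rewrite -subr_eq0 => /eqP <-; ring.
Qed.

Lemma psd_sub_conj a u v :
  B (u - a *: v) (u - a *: v) = B u u + `|a| ^+ 2 * B v v - (a^* * B u v + (a^* * B u v)^*).
Proof. by rewrite !psdE (psd_herm u v) normCK rmorphM /= conjCK; ring. Qed.

Lemma phase_exists (z : C) : exists2 a : C, `|a| = 1 & a^* * z = `|z|.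
Proof.
have [->|z0] := eqVneq z 0.
  by exists 1; rewrite ?normr1 ?mulr0 ?normr0.
have nz0 : `|z| != 0 by rewrite normr_eq0.
exists (z / `|z|); first by rewrite normf_div normr_id divff.
rewrite rmorphM fmorphV /= -[in LHS](normr_id z) conj_normC normr_id.
by rewrite mulrAC (mulrC z^*) -normCK expr2 mulfK.
Qed.

(** Rotating [v] by a phase makes [B u v] real and nonnegative; expand
    [0 <= B (u - a v) (u - a v)].  This replaces the Cauchy-Schwarz inequality
    and needs no square root of the possibly degenerate form. *)
Lemma psd_amgm u v : 2 * `|B u v| <= B u u + B v v.
Proof.
have [a na az] := phase_exists (B u v).
have := psd_ge0 psdB (u - a *: v).
rewrite psd_sub_conj na az expr1n mul1r conj_normC subr_ge0 -mulr2n.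
by rewrite mulr_natl.
Qed.

(** Buzano's inequality, in additive form.  The reflection
    [w = 2 <a,e> e - a] of [a] across the line of [e] has the same seminorm as
    [a], and [2 <a,e> <e,b> = <w,b> + <a,b>]. *)
Lemma psd_buzano (a b e : U) : B e e = 1 ->
  4 * (`|B a e| * `|B e b|) <= B a a + B b b + 2 * `|B a b|.
Proof.
move=> e1; pose w := (2 * B a e) *: e - a.
have ww : B w w = B a a.
  rewrite /w !psdE e1 (psd_herm a e) rmorphM /= conjC_nat; ring.
have wb : B w b = 2 * (B a e * B e b) - B a b by rewrite /w !psdE; ring.
have -> : 4 * (`|B a e| * `|B e b|) = 2 * `|B w b + B a b|.
  rewrite wb subrK !normrM normr_nat; ring.
have := psd_amgm w b; rewrite ww => h.
apply: le_trans (_ : 2 * (`|B w b| + `|B a b|) <= _).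
  by rewrite ler_pM2l ?ler_normD ?ltr0n.
by rewrite mulrDr lerD2r.
Qed.

Lemma psd_adj_sym (T S : U -> U) : (forall u v, B (T u) v = B u (S v)) ->
  forall u v, B (S u) v = B u (T v).
Proof. by move=> TS u v; rewrite psd_herm -TS -psd_herm. Qed.

(** Since [P] fixes the range of [N] and is self-adjoint,
    [B (N u) u = B (N u) (P u)]; idempotence turns [B (P u) (P u)] back into
    [B (P u) u]. *)
Lemma psd_projection_bound (N S P : U -> U) u :
  (forall u v, B (N u) v = B u (S v)) -> (forall u v, B (P u) v = B u (P v)) ->
  (forall u, P (N u) = N u) -> (forall u, P (P u) = P u) ->
  2 * `|B (N u) u| <= `|B (S (N u) + P u) u|.
Proof.
move=> NS PP PN Pid; rewrite psdDl (psd_adj_sym NS).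
rewrite -[N u in leLHS]PN -[P u in leRHS]Pid (PP (N u)) (PP (P u)).
by rewrite [leRHS]ger0_norm ?psd_amgm // addr_ge0 ?(psd_ge0 psdB).
Qed.

(** Buzano's inequality for [a = N u], [b = S u] and [e = u]: both factors on its
    left have modulus [|B (N u) u|]. *)
Lemma psd_square_bound (N S : U -> U) u :
  (forall u v, B (N u) v = B u (S v)) -> B u u = 1 ->
  4 * `|B (N u) u| ^+ 2 <= `|B (S (N u) + N (S u)) u| + 2 * `|B (N (N u)) u|.
Proof.
move=> NS u1; rewrite psdDl (psd_adj_sym NS) (NS (S u)) (NS (N u)).
rewrite (@ger0_norm _ (_ + _)) ?addr_ge0 ?(psd_ge0 psdB) //.
by have := psd_buzano (N u) (S u) u1; rewrite -(NS u u) -expr2.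
Qed.
End PsdForm.

(** * Riesz representation *)

Section Riesz.
Variables (R : realType) (V : completeNormedModType R[i]).
Variable dp : V -> V -> R[i].
Hypothesis psd_dp : psd_form dp.
Hypothesis dp_norm : forall u, dp u u = `|u| ^+ 2.
Implicit Types u v w : V.

Lemma cauchy_schwarz u v : `|dp u v| <= `|u| * `|v|.
Proof.
have [->|u0] := eqVneq u 0; first by rewrite (psd0l psd_dp) !normr0 mul0r.
have [->|v0] := eqVneq v 0; first by rewrite (psd0r psd_dp) !normr0 mulr0.
have nu0 : 0 < `|u| by rewrite normr_gt0.
have nv0 : 0 < `|v| by rewrite normr_gt0.
(* These multiples of [u] and [v] have the same norm, the equality case of the
   arithmetic-geometric inequality. *)
have := psd_amgm psd_dp (`|v| *: u) (`|u| *: v).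
rewrite !dp_norm !normrZ !normr_id !(psdZl psd_dp) !(psdZr psd_dp) !normrM.
rewrite norm_conjC !normr_id => h.
have uv0 : 0 < 2 * (`|v| * `|u|) by rewrite !mulr_gt0 ?ltr0n.
rewrite -(ler_pM2l uv0); apply: le_trans (_ : _ <= (`|v| * `|u|) ^+ 2 + (`|u| * `|v|) ^+ 2) _.
  by apply: le_trans h; rewrite !mulrA.
by rewrite le_eqVlt; apply/orP; left; apply/eqP; ring.
Qed.

Lemma dp_nondegenerate u w : (forall v, dp v u = dp v w) -> u = w.
Proof.
move=> h; apply/eqP; rewrite -subr_eq0 -normr_eq0 -sqrf_eq0 -dp_norm.
by rewrite (psdDr psd_dp) (psdNr psd_dp) h subrr.
Qed.

Variable f : V -> R[i].
Hypothesis f_lin : forall a u v, f (a *: u + v) = a * f u + f v.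
Variable C : R.
Hypothesis f_bounded : forall u, `|f u| <= C%:C%C * `|u|.

(** [|u|^2 - 2 Re (f u)], which is [|u - k|^2 - |k|^2] if [k] represents [f]; so
    the representing vector is its minimizer. *)
Let energy u : R := complex.Re (`|u| ^+ 2 - (f u + (f u)^*)).

Lemma energyE u : (energy u)%:C%C = `|u| ^+ 2 - (f u + (f u)^*).
Proof.
apply: RRe_real; apply/CrealP.
rewrite rmorphB rmorphD rmorphXn /= (conj_Creal (normr_real u)) conjCK.
by rewrite [f u + _]addrC.
Qed.

Lemma energy_ge u : - C ^+ 2 <= energy u.
Proof.
have fr : f u + (f u)^* \is Num.real.
  by apply/CrealP; rewrite rmorphD /= conjCK addrC.
have fC : f u + (f u)^* <= 2 * (C%:C%C * `|u|).
  apply: le_trans (real_ler_norm fr) _; apply: le_trans (ler_normD _ _) _.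
  by rewrite norm_conjC -mulr2n mulr_natl lerMn2r f_bounded orbT.
have sq : 0 <= (`|u| - C%:C%C) ^+ 2.
  rewrite -realEsqr rpredB ?normr_real //; apply/complex_realP; by exists C.
rewrite -lecR energyE rmorphN rmorphXn /= lerBrDr addrC lerBlDr.
apply: le_trans fC _ => /=.
rewrite -subr_ge0; move: sq; congr (0 <= _); ring.
Qed.

Lemma energy_shift u w : (energy (u + w))%:C%C =
  (energy u)%:C%C + `|w| ^+ 2 + ((dp w u - f w) + (dp w u - f w)^*).
Proof.
have fD : f (u + w) = f u + f w by have := f_lin 1 u w; rewrite scale1r mul1r.
rewrite !energyE fD -!dp_norm !(psdE psd_dp) (psd_herm psd_dp w u) rmorphB rmorphD /=.
ring.
Qed.

(** First-order optimality: if [energy u] is within [e^2] of the infimum, the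
    directional defect [g = dp v u - f v] cannot exceed [e |v|], since moving
    from [u] along [v] by the best step lowers the energy by [|g|^2 / |v|^2]. *)
Lemma almost_representer (e : R) : 0 < e ->
  exists u, forall v, `|dp v u - f v| <= e%:C%C * `|v|.
Proof.
move=> e0; pose S := range energy.
have lbS : has_lbound S by exists (- C ^+ 2) => _ [u _ <-]; exact: energy_ge.
have infS : has_inf S by split => //; exists (energy 0); exists 0.
have [_ [u _ <-] ult] := inf_adherent (exprn_gt0 2 e0) infS.
exists u => v; set g := dp v u - f v.
have fZ a x : f (a *: x) = a * f x.
  have f0 : f 0 = 0.
    by apply: (@addrI _ (f 0)); have := f_lin 1 0 0; rewrite scale1r addr0 mul1r addr0.
  by have := f_lin a x 0; rewrite !addr0 f0 addr0.
have [v0|v0] := eqVneq v 0.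
  have f0 : f 0 = 0 by have := fZ 0 0; rewrite scale0r mul0r.
  by rewrite /g v0 (psd0l psd_dp) f0 subr0 !normr0 mulr0.
have nv0 : 0 < `|v| by rewrite normr_gt0.
(* [w] minimizes the energy of [u + w] on the complex line of [v]. *)
pose w := - (g^* / `|v| ^+ 2) *: v.
pose q := `|g| ^+ 2 / `|v| ^+ 2.
have nv20 : `|v| ^+ 2 != 0 by rewrite expf_neq0 // gt_eqF.
have qE : dp w u - f w = - q.
  rewrite /w (psdZl psd_dp) fZ -mulrBr -/g /q normCK; ring.
have wE : `|w| ^+ 2 = q.
  rewrite /w normrZ normrN normrM normfV norm_conjC normrX normr_id /q.
  by field; rewrite gt_eqF.
have q0 : 0 <= q by rewrite divr_ge0 // exprn_ge0.
have qr : q^* = q by apply/CrealP/ger0_real.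
have := energy_shift u w; rewrite qE wE rmorphN /= qr => shift.
have : inf S <= energy (u + w) by apply: ge_inf => //; exists (u + w).
move=> /(lt_le_trans _) - /(_ (energy u - e ^+ 2)); rewrite ltrBlDr => /(_ ult).
rewrite ltrBlDl -ltrBlDr => /ltW; rewrite -lecR rmorphB /= shift => h.
have {h} : q <= (e%:C%C) ^+ 2.
  move: h; rewrite rmorphXn /=; congr (_ <= _); ring.
rewrite /q ler_pdivrMr ?exprn_gt0 // -exprMn => h.
by rewrite -(@ler_pXn2r _ 2) ?nnegrE // mulr_ge0 // ler0c ltW.
Qed.

(** Two approximate representers are close: testing both against their
    difference bounds its norm by the sum of their tolerances.  They therefore
    form a Cauchy sequence, whose limit represents [f] by continuity. *)
Theorem riesz_representation : exists k, forall v, f v = dp v k.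
Proof.
pose eps n : R[i] := (n.+1%:R^-1 : R)%:C%C.
have /choice[u_ uP] n : exists u, forall v, `|dp v u - f v| <= eps n * `|v|.
  by apply: almost_representer; rewrite invr_gt0 ltr0n.
have dist m n : `|u_ m - u_ n| <= eps m + eps n.
  have [->|mn] := eqVneq (u_ m) (u_ n).
    by rewrite subrr normr0 addr_ge0 // ler0c invr_ge0.
  set v := u_ m - u_ n.
  have nv0 : 0 < `|v| by rewrite normr_gt0 subr_eq0.
  rewrite -(ler_pM2r nv0) -expr2 -dp_norm {2}/v (psdDr psd_dp) (psdNr psd_dp).
  apply: (@le_trans _ _ `|(dp v (u_ m) - f v) - (dp v (u_ n) - f v)|).
    rewrite opprB addrA subrK real_ler_norm //.
    by rewrite -(psdNr psd_dp) -(psdDr psd_dp) -/v ger0_real ?(psd_ge0 psd_dp).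
  by rewrite mulrDl (le_trans (ler_normB _ _)) // lerD.
have eps_small (r : R[i]) : 0 < r -> \forall n \near \oo, eps n < r.
  move=> r0; have rE : (complex.Re r)%:C%C = r by apply: RRe_real; exact: gtr0_real.
  have rr : 0 < complex.Re r by rewrite -ltcR rE.
  apply: filterS (near_infty_natSinv_lt (PosNum rr)) => n nr.
  by rewrite -rE ltcR.
have ucvg : cvg (u_ @ \oo).
  apply/cauchy_cvgP/cauchy_exP => r r0.
  have r20 : 0 < r / 2 by rewrite divr_gt0 ?ltr0n.
  have [n _ nP] := eps_small _ r20.
  exists (u_ n); apply: filterS (eps_small _ r20) => m mr.
  rewrite -ball_normE; apply: le_lt_trans (dist _ _) _.
  by rewrite [ltRHS]splitr ltrD // nP /=.
exists (lim (u_ @ \oo)) => v; apply/esym/eqP; rewrite -subr_eq0 -normr_le0.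
apply/ler_addgt0Pr => r r0; rewrite add0r.
set k := lim _.
have v1 : 0 < 2 * (1 + `|v|) by rewrite mulr_gt0 ?ltr0n // ltr_wpDr ?normr_ge0 ?ltr01.
(* The [1 +] keeps the tolerance meaningful when [v] is zero. *)
have rv : 0 < r / (2 * (1 + `|v|)) by rewrite divr_gt0.
have [n] : exists n, `|k - u_ n| <= r / (2 * (1 + `|v|)) /\ eps n <= r / (2 * (1 + `|v|)).
  apply: (@filter_ex _ (\oo : set_system nat)); near=> n; split.
    by near: n; move/cvgrPdist_le: ucvg; apply.
  by apply: ltW; near: n; exact: eps_small.
move=> [kn en].
have -> : dp v k - f v = dp v (k - u_ n) + (dp v (u_ n) - f v).
  by rewrite (psdDr psd_dp) (psdNr psd_dp) addrA subrK.
apply: le_trans (ler_normD _ _) _.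
apply: le_trans (lerD (cauchy_schwarz _ _) (uP n v)) _.
apply: (@le_trans _ _ (r / (2 * (1 + `|v|)) * `|v| + r / (2 * (1 + `|v|)) * `|v|)).
  by apply: lerD; [rewrite mulrC|]; apply: ler_wpM2r.
have -> : r / (2 * (1 + `|v|)) * `|v| + r / (2 * (1 + `|v|)) * `|v| = r * (`|v| / (1 + `|v|)).
  by field; rewrite gt_eqF // ltr_wpDr ?normr_ge0 ?ltr01.
rewrite ler_piMr ?(ltW r0) // ler_pdivrMr ?ltr_wpDr ?normr_ge0 ?ltr01 //.
by rewrite mul1r lerDr.
Unshelve. all: by end_near.
Qed.
End Riesz.

(** * Adjoints and the A-Berezin number *)

Lemma Re_normr_ge0 (R : realType) (z : R[i]) : 0 <= complex.Re `|z|.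
Proof. by rewrite -lecR RRe_real ?normr_real //; exact: normr_ge0. Qed.

Section Berezin.
Variables (R : realType) (X : Type) (H : rkhs R X).
Implicit Types (A T S N : H -> H) (u v : H) (x : X).

Lemma dot_psd : psd_form (dot H).
Proof.
split=> [a u v w|a u v w|u]; first exact: linearPl.
- exact: linearPr.
- exact: dnorm_ge0.
Qed.

Lemma bounded_op_comp T S : bounded_op T -> bounded_op S -> bounded_op (T \o S).
Proof.
move=> [Tl [c Tc]] [Sl [d Sd]]; split.
  by move=> a u v /=; rewrite Sl Tl.
exists (`|c| * `|d|) => u /=; apply: le_trans (Tc _) _.
apply: (@le_trans _ _ (`|c|%:C%C * `|S u|)).
  by rewrite ler_wpM2r // lecR ler_norm.
rewrite rmorphM -mulrA ler_wpM2l ?ler0c // (le_trans (Sd u)) //.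
by rewrite ler_wpM2r // lecR ler_norm.
Qed.

(** [adj T] is selected by [get], so all that has to be shown is that an adjoint
    exists; Riesz applied to [u |-> <T u, v>] provides it pointwise in [v]. *)
Lemma adjP T : bounded_op T -> forall u v, dot H (T u) v = dot H u (adj T v).
Proof.
move=> [Tl [c Tc]].
have c0 u : `|T u| <= `|c|%:C%C * `|u|.
  by apply: le_trans (Tc u) _; rewrite ler_wpM2r // lecR ler_norm.
have /choice[S SP] v : exists k, forall u, dot H (T u) v = dot H u k.
  apply: (@riesz_representation _ _ _ dot_psd (@dot_norm _ _ H)
            (fun u => dot H (T u) v) _ (`|c| * complex.Re `|v|)).
    by move=> a u w; rewrite Tl (psd_linl dot_psd).
  move=> u; apply: le_trans (cauchy_schwarz dot_psd (@dot_norm _ _ H) _ _) _.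
  have -> : (`|c| * complex.Re `|v|)%:C%C = `|c|%:C%C * `|v|.
    by rewrite rmorphM /= (RRe_real (normr_real v)).
  by rewrite mulrAC ler_wpM2r.
suff : exists S, bounded_op S /\ forall u v, dot H (T u) v = dot H u (S v).
  by case/(@getPex _ [set S | _]).
exists S; split => //; split.
  move=> a v w; apply: (dp_nondegenerate dot_psd (@dot_norm _ _ H)) => u.
  by rewrite -SP !(psd_linr dot_psd) !SP.
exists `|c| => v.
have [->|Sv0] := eqVneq (S v) 0; first by rewrite normr0 mulr_ge0 // ler0c.
rewrite -(@ler_pM2l _ `|S v|) ?normr_gt0 // -expr2 -dot_norm -SP.
apply: le_trans (real_ler_norm _) _.
  by rewrite SP dot_norm rpredX // normr_real.
apply: le_trans (cauchy_schwarz dot_psd (@dot_norm _ _ H) _ _) _.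
by rewrite mulrA (mulrC `|S v|) ler_wpM2r.
Qed.

Section SemiInnerProduct.
Variable A : H -> H.
Hypothesis A_pos : positive_op A.

Lemma dotA_psd : psd_form (dotA A).
Proof.
have [[Al _] A0] := A_pos; split=> // [a u v w|a u v w].
  by rewrite /dotA Al (psd_linl dot_psd).
by rewrite /dotA (psd_linr dot_psd).
Qed.

Lemma positive_op_sym u v : dot H (A u) v = dot H u (A v).
Proof.
by rewrite -/(dotA A u v) (psd_herm dotA_psd) (psd_herm dot_psd).
Qed.

(** The equation [A S = T^* A], shared by the definitions of [T^{#_A}] and of the
    [A]-generalized inverse, says that [S] is an adjoint of [T] for [<.,.>_A]. *)
Lemma dotA_adjoint T S : bounded_op T -> A \o S = adj T \o A ->
  forall u v, dotA A (T u) v = dotA A u (S v).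
Proof.
move=> Tb /(congr1 (fun f => f _)) AS u v.
rewrite /dotA positive_op_sym (adjP Tb) positive_op_sym.
by have /= -> := AS v.
Qed.

Lemma dotA_nkerA x : normA A (rker x) != 0 -> dotA A (nkerA A x) (nkerA A x) = 1.
Proof.
rewrite /nkerA /normA => nx; set t := _^-1.
have tr : t%:C%C \is Num.real by apply/complex_realP; exists t.
rewrite (psdZl dotA_psd) (psdZr dotA_psd) (conj_Creal tr).
move: nx; rewrite {tr}/t; set z := dotA A _ _.
have z0 : 0 <= z := psd_ge0 dotA_psd _.
have zE : (complex.Re z)%:C%C = z := RRe_real (ger0_real z0).
have Rez0 : 0 <= complex.Re z by rewrite -lecR zE.
move=> nx; rewrite -{3}zE -!rmorphM /= -{3}(sqr_sqrtr Rez0) expr2.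
by rewrite mulKf // mulVf.
Qed.

Lemma berA_ge T x : normA A (rker x) != 0 ->
  ((complex.Re `|dotA A (T (nkerA A x)) (nkerA A x)|)%:E <= berA A T)%E.
Proof. by move=> nx; apply: ereal_sup_ubound; right; exists x. Qed.

Lemma berA_ge0 T : (0 <= berA A T)%E.
Proof. by apply: ereal_sup_ubound; left. Qed.

(** Taking the square root of [c] in [[0, +oo]] reduces the bound on the square
    of the supremum to one on each value, whether or not [c] is finite. *)
Lemma berA_sqr_le T (c : \bar R) : (0 <= c)%E ->
  (forall x, normA A (rker x) != 0 ->
    (((complex.Re `|dotA A (T (nkerA A x)) (nkerA A x)|) ^+ 2)%:E <= c)%E) ->
  (berA A T ^+ 2 <= c)%E.
Proof.
move=> c0 h; rewrite -(sqr_sqrte c0) lee_sqr ?berA_ge0 ?sqrte_ge0 //.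
apply: ge_ereal_sup => _ [->|[x nx <-]]; first exact: sqrte_ge0.
have ev0 : 0 <= complex.Re `|dotA A (T (nkerA A x)) (nkerA A x)|.
  exact: Re_normr_ge0.
by rewrite -lee_sqr ?sqrte_ge0 ?lee_fin // sqr_sqrte // -EFin_expe h.
Qed.

End SemiInnerProduct.
End Berezin.

Theorem theorem3p4 (R : realType) (X : Type) (X_nonempty : inhabited X)
    (H : rkhs R X) (A : H -> H) (A_pos : positive_op A)
    (M N : H -> H) (M_BA : BA A M) (N_BA : BA A N)
    (M_closed : closed (range M)) (N_closed : closed (range N))
    (M_range_compat : compatible A (range M))
    (M_null_compat : compatible A (nullspace M))
    (N_range_compat : compatible A (range N))
    (N_null_compat : compatible A (nullspace N))
    (Nsharp : H -> H) (Nsharp_def : is_sharpA A N Nsharp)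
    (Ndag : H -> H) (Ndag_def : is_ginvA A N Ndag) :
  (berA A (M \+ N)%R ^+ 2 <=
     berA A M ^+ 2
     + berA A M * berA A ((Nsharp \o N) \+ (N \o Ndag))%R
     + (4^-1)%:E * berA A ((Nsharp \o N) \+ (N \o Nsharp))%R
     + (2^-1)%:E * berA A (N \o N))%E.
Proof.
have [Nb _] := N_BA; have [_ Nsharp_adj _] := Nsharp_def.
have [Ndag_b NdagN _ P_adj _] := Ndag_def.
have NN := dotA_adjoint A_pos Nb Nsharp_adj.
have PP := dotA_adjoint A_pos (bounded_op_comp Nb Ndag_b) P_adj.
have PN u : N (Ndag (N u)) = N u := congr1 (fun f => f u) NdagN.
apply: berA_sqr_le => [|x nx].
  by rewrite !adde_ge0 ?mule_ge0 ?sqre_ge0 ?berA_ge0 // lee_fin invr_ge0 ler0n.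
set k := nkerA A x.
pose ev T : R := complex.Re `|dotA A (T k) k|.
have evE T : (ev T)%:C%C = `|dotA A (T k) k| by rewrite RRe_real ?normr_real.
have ev0 T : 0 <= ev T by exact: Re_normr_ge0.
have evB T : ((ev T)%:E <= berA A T)%E by exact: berA_ge.
have add : ev (M \+ N) <= ev M + ev N.
  rewrite -lecR rmorphD /= !evE (psdDl (dotA_psd A_pos)); exact: ler_normD.
have half : 2 * ev N <= ev ((Nsharp \o N) \+ (N \o Ndag)).
  rewrite -lecR rmorphM rmorph_nat /= !evE.
  exact: (psd_projection_bound (dotA_psd A_pos) k NN PP PN (fun u => PN (Ndag u))).
have square : 4 * ev N ^+ 2 <= ev ((Nsharp \o N) \+ (N \o Nsharp)) + 2 * ev (N \o N).
  rewrite -lecR rmorphD (rmorphM _ 4) rmorphXn (rmorphM _ 2) !rmorph_nat /= !evE.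
  exact: (psd_square_bound (dotA_psd A_pos) NN (dotA_nkerA A_pos nx)).
apply: (@le_trans _ _ (ev M ^+ 2 + ev M * ev ((Nsharp \o N) \+ (N \o Ndag))
   + 4^-1 * ev ((Nsharp \o N) \+ (N \o Nsharp)) + 2^-1 * ev (N \o N))%:E).
  rewrite lee_fin; apply: (@le_trans _ _ ((ev M + ev N) ^+ 2)).
    by apply: lerXn2r add; rewrite nnegrE ?addr_ge0 ?ev0.
  have := ler_wpM2l (ev0 M) half.
  move: square; lra.
rewrite !EFinD !EFinM !leeD ?lee_pmul ?lee_fin ?invr_ge0 ?ler0n //.
Qed.
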